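(* Let $\kappa \in \mathcal{S}_{-1}$ and let $k$ be its associate Sonine kernel. Then: (i) the general fractional derivative $\mathbb{D}_{(k)}$ of Riemann--Liouville type is a left inverse operator to the general fractional integral $\mathbb{I}_{(\kappa)}$ on the space $C_{-1}(0,+\infty)$, i.e. $$(\mathbb{D}_{(k)}\, \mathbb{I}_{(\kappa)}\, f)(t) = f(t),\quad t>0,\ \text{ for all } f\in C_{-1}(0,+\infty);$$ (ii) the general fractional derivative ${}_*\mathbb{D}_{(k)}$ of Caputo type is a left inverse operator to $\mathbb{I}_{(\kappa)}$ on the space $C_{-1,k}(0,+\infty) := \{f:\ f(t)=(\mathbb{I}_{(k)}\, \phi)(t),\ \phi\in C_{-1}(0,+\infty)\}$, i.e. $$({}_*\mathbb{D}_{(k)}\, \mathbb{I}_{(\kappa)}\, f)(t) = f(t),\quad t>0,\ \text{ for all } f\in C_{-1,k}(0,+\infty).$$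
   Context: Functions on $(0,+\infty)$ are real-valued (or all complex-valued). $C_{-1}(0,+\infty)$ is the set of functions $f$ on $(0,+\infty)$ that can be written as $f(t)=t^{p-1}f_1(t)$, $t>0$, for some $p>0$ and some $f_1\in C[0,+\infty)$. $C_{-1,0}(0,+\infty)$ is the set of functions $f$ on $(0,+\infty)$ that can be written as $f(t)=t^{p-1}f_1(t)$, $t>0$, for some $0<p<1$ and some $f_1\in C[0,+\infty)$. (The exponents $p$ depend on $f$.) The Laplace convolution is $(f*g)(t)=\int_0^t f(t-\tau)g(\tau)\,d\tau$, $t>0$. $\kappa\in\mathcal{S}_{-1}$ means that $\kappa\in C_{-1,0}(0,+\infty)$ and there is $k\in C_{-1,0}(0,+\infty)$ with $(\kappa*k)(t)=1$ for all $t>0$ (the Sonine condition). Such a $k$ is unique, also belongs to $\mathcal{S}_{-1}$, and is called the associate Sonine kernel of $\kappa$. For a kernel $\kappa\in \mathcal{S}_{-1}$ the general fractional integral is $(\mathbb{I}_{(\kappa)} f)(t)=(\kappa*f)(t)$, $t>0$. The general fractional derivatives with kernel $k$ are $$(\mathbb{D}_{(k)} f)(t)=\frac{d}{dt}(k*f)(t),\qquad ({}_*\mathbb{D}_{(k)} f)(t)=(\mathbb{D}_{(k)} f)(t)-f(0)k(t),\qquad t>0,$$ where, for a function $g$ defined on $(0,+\infty)$, $g(0)$ means $\lim_{t\to 0+}g(t)$. *)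

(* Defs.v *)
From HB Require Import structures.
From mathcomp Require Import all_boot all_order all_algebra.
From mathcomp Require Import all_classical all_reals all_analysis.

Set Implicit Arguments.
Unset Strict Implicit.
Unset Printing Implicit Defensive.

Import Order.TTheory GRing.Theory Num.Theory.
Import numFieldNormedType.Exports.

Local Open Scope classical_set_scope.
Local Open Scope ring_scope.

(* A function on (0, +oo) is represented by a total function R -> R whose
   values outside (0, +oo) are irrelevant: every definition below only looks
   at its values at positive arguments. *)

Definition weighted_continuous (R : realType) (p : R) (f : R -> R) : Prop :=
  exists2 f1 : R -> R, {within `[0, +oo[, continuous f1} &
    forall t : R, 0 < t -> f t = t `^ (p - 1) * f1 t.

Definition Cm1 (R : realType) : set (R -> R) :=
  [set f | exists2 p : R, 0 < p & weighted_continuous p f].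

Definition Cm1_0 (R : realType) : set (R -> R) :=
  [set f | exists2 p : R, 0 < p < 1 & weighted_continuous p f].

Definition lconv (R : realType) (f g : R -> R) (t : R) : R :=
  \int[@lebesgue_measure R]_(tau in `]0, t[) (f (t - tau) * g tau).

(* Rintegral is a total operation; this says that the integral defining
   lconv f g t actually converges. *)
Definition lconv_defined (R : realType) (f g : R -> R) (t : R) : Prop :=
  (@lebesgue_measure R).-integrable `]0, t[
    (fun tau => (f (t - tau) * g tau)%:E).

Definition associate_sonine_kernel (R : realType) (kappa k : R -> R) : Prop :=
  @Cm1_0 R k /\ forall t : R, 0 < t -> lconv kappa k t = 1.

Definition Sm1 (R : realType) : set (R -> R) :=
  [set kappa | @Cm1_0 R kappa /\
               exists k : R -> R, associate_sonine_kernel kappa k].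

Definition GFI (R : realType) (kappa f : R -> R) : R -> R := lconv kappa f.

Definition GFD_RL (R : realType) (k f : R -> R) (t : R) : R :=
  derive1 (lconv k f) t.

(* The value g(0) is the right limit of g at 0. *)
Definition value0 (R : realType) (g : R -> R) : R := lim (g x @[x --> 0^'+]).

Definition GFD_Caputo (R : realType) (k f : R -> R) (t : R) : R :=
  GFD_RL k f t - value0 f * k t.

(* Derivatives and limits are total operations too; the two predicates below
   say that the right-hand sides of GFD_RL and GFD_Caputo make sense at t. *)
Definition GFD_RL_defined (R : realType) (k f : R -> R) (t : R) : Prop :=
  (forall s : R, 0 < s -> lconv_defined k f s) /\ derivable (lconv k f) t 1.

Definition GFD_Caputo_defined (R : realType) (k f : R -> R) (t : R) : Prop :=
  GFD_RL_defined k f t /\ cvg (f x @[x --> 0^'+]).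

Definition Cm1_k (R : realType) (k : R -> R) : set (R -> R) :=
  [set f | exists2 phi : R -> R, @Cm1 R phi &
             forall t : R, 0 < t -> f t = GFI k phi t].

(* Main.v *)
Require Import Defs.
From HB Require Import structures.
From mathcomp Require Import all_boot all_order all_algebra.
From mathcomp Require Import all_classical all_reals all_analysis.
From mathcomp Require Import measurable_realfun ring lra.

Set Implicit Arguments.
Unset Strict Implicit.
Unset Printing Implicit Defensive.

Import Order.TTheory GRing.Theory Num.Theory.
Import numFieldNormedType.Exports.

Local Open Scope classical_set_scope.
Local Open Scope ring_scope.

(* Since C_{-1} is closed under convolution, Fubini makes convolution associative
   and commutative on it, so k * (kappa * f) = (kappa * k) * f = 1 * f, the
   primitive of f from 0, whose derivative at t > 0 is f t as f is continuous
   there. For the Caputo derivative write f = k * phi: then f is again in C_{-1},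
   and kappa * f = 1 * phi tends to 0 at 0+, so the correction term vanishes. *)

(** * Affine substitution in Lebesgue integrals over the line *)

Section affine_change_of_variables.
Context {R : realType}.
Notation mu := (@lebesgue_measure R).
Variables (a b : R).
Hypothesis a0 : a != 0.

Let phi (x : measurableTypeR R) : measurableTypeR R := a * x + b.

Let mphi : measurable_fun setT phi.
Proof. by apply: measurable_funD => //; exact: measurable_funM. Qed.

(** The right-hand side is itself a measure, a scaled pushforward, so by uniqueness of Lebesgue
    measure it suffices to compare both sides on the intervals []u, v]]. *)
Lemma lebesgue_measure_affine (A : set (measurableTypeR R)) : measurable A ->
  mu A = (`|a|%:E * mu ((fun x => a * x + b)%R @^-1` A))%E.
Proof.
pose m : {measure set (measurableTypeR R) -> \bar R} :=
  mscale (NngNum (normr_ge0 a)) (pushforward mu phi).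
move=> mA; rewrite (@lebesgue_measure_unique _ (m mphi))//.
move=> X /ocitvP[->|[[u v] /= uv ->]]; first by rewrite !measure0.
rewrite /m /mscale/= /pushforward/= lebesgue_measure_itv/= lte_fin uv.
have [a_gt0|a_lt0] : 0 < a \/ a < 0.
  by apply/orP; rewrite orbC -neq_lt.
- rewrite (_ : _ @^-1` _ = [set` `](u - b) / a, (v - b) / a]]); last first.
    apply/seteqP; split => x /=; rewrite !in_itv/= /phi.
      by move=> /andP[? ?]; rewrite ltr_pdivrMr// ler_pdivlMr//; lra.
    by rewrite ltr_pdivrMr// ler_pdivlMr// => /andP[? ?]; lra.
  rewrite lebesgue_measure_itv/= lte_fin ltr_pM2r ?invr_gt0// ltrD2r uv.
  by rewrite gtr0_norm// -!EFinB -EFinM; congr EFin; field.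
(* For [a < 0] orientation is reversed, so the preimage of []u, v]] is closed on the left and open
   on the right. *)
- rewrite (_ : _ @^-1` _ = [set` `[(v - b) / a, (u - b) / a[]); last first.
    apply/seteqP; split => x /=; rewrite !in_itv/= /phi.
      by move=> /andP[? ?]; rewrite ler_ndivrMr// ltr_ndivlMr//; lra.
    by rewrite ler_ndivrMr// ltr_ndivlMr// => /andP[? ?]; lra.
  rewrite lebesgue_measure_itv/= lte_fin ltr_nM2r ?invr_lt0// ltrD2r uv.
  by rewrite ltr0_norm// -!EFinB -EFinM; congr EFin; field.
Qed.

Lemma ge0_integral_affine (f : R -> \bar R) :
  measurable_fun (setT : set (measurableTypeR R)) f ->
  (forall x, 0 <= f x)%E ->
  (\int[mu]_x f x = `|a|%:E * \int[mu]_x f (a * x + b)%R)%E.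
Proof.
move=> mf f0.
pose m : {measure set (measurableTypeR R) -> \bar R} := pushforward mu phi.
transitivity (\int[mscale (NngNum (normr_ge0 a)) (m mphi)]_x f x)%E.
  by apply: eq_measure_integral => A mA _; exact: lebesgue_measure_affine.
by rewrite ge0_integral_mscale//= ge0_integral_pushforward.
Qed.

Lemma integrable_affine (f : R -> \bar R) :
  mu.-integrable setT f -> mu.-integrable setT (fun x => f (a * x + b)).
Proof.
move=> /integrableP[mf foo]; apply/integrableP; split.
  exact: measurableT_comp mf mphi.
move: foo; rewrite (ge0_integral_affine _ (fun=> abse_ge0 _))//; last first.
  exact: measurableT_comp.
(* Were the substituted integral [+oo], its product with the positive number [|a|] would be [+oo] as
   well. *)
case: (\int[mu]_x _)%E => [r||]//=; rewrite ?ltry//.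
by rewrite gt0_muley// lte_fin normr_gt0.
Qed.

Lemma integral_affine (f : R -> \bar R) : mu.-integrable setT f ->
  (\int[mu]_x f x = `|a|%:E * \int[mu]_x f (a * x + b)%R)%E.
Proof.
move=> fi; have mf := measurable_int _ fi.
have fi' := integrable_affine fi.
rewrite [RHS](_ : _ = `|a|%:E *
  (\int[mu]_x f^\+ (a * x + b)%R - \int[mu]_x f^\- (a * x + b)%R))%E; last first.
  by congr (_ * _)%E; rewrite integralE; congr (_ - _)%E;
    apply: eq_integral => x _; rewrite ?funeposE ?funenegE.
rewrite integralE (@ge0_integral_affine (f^\+)%E)//; last first.
  exact: measurable_funepos.
rewrite (@ge0_integral_affine (f^\-)%E)//; last exact: measurable_funeneg.
(* Distributing the factor requires that the difference is not [+oo - +oo]; integrability makes the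
   positive part finite. *)
rewrite [RHS]muleBr//; apply: fin_num_adde_defr.
apply: integrable_fin_num => //.
by apply: eq_integrable (integrable_funepos _ fi') => // x _; rewrite !funeposE.
Qed.

End affine_change_of_variables.

(** * Integrability of the beta weight on the unit interval *)

Section beta_weight.
Context {R : realType}.
Notation mu := (@lebesgue_measure R).

(** On [[1/(n+1), 1]] the primitive [p^-1 * x^p] bounds the integral by [p^-1], uniformly in [n];
    monotone convergence carries the bound over to []0, 1]]. *)
Lemma integrable_powR01 (p : R) : 0 < p ->
  mu.-integrable `]0, 1[ (fun u => (u `^ (p - 1))%:E).
Proof.
move=> p0.
pose F n := [set` `[n.+1%:R^-1 : R, 1]].
have Fn n : (\int[mu]_(x in F n) (x `^ (p - 1))%:E <= (p^-1)%:E)%E.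
  (* At [n = 0] the segment is the single point 1, whereas the fundamental theorem needs distinct
     endpoints. *)
  have [->|n0] := eqVneq n 0%N.
    by rewrite /F invr1 set_itv1 integral_set1 lee_fin invr_ge0 ltW.
  have ainv : 0 < n.+1%:R^-1 :> R by rewrite invr_gt0.
  have a1 : n.+1%:R^-1 < 1 :> R by rewrite invf_lt1// ltr1n ltnS lt0n.
  have dG (x : R^o) : 0 < x -> is_derive x 1 (fun y => p^-1 * y `^ p) (x `^ (p - 1)).
    move=> x0; have := is_derive1_powR p x0 => d.
    apply: (is_derive_eq (@is_deriveZ R R^o R^o _ p^-1 x 1 _ d)).
    by rewrite /GRing.scale/= mulrA mulVf ?mul1r ?gt_eqF.
  have cG (x : R) : 0 < x -> {for x, continuous (fun y => p^-1 * y `^ p)}.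
    by move=> x0; apply: differentiable_continuous; apply/derivable1_diffP; case: (dG _ x0).
  rewrite (@continuous_FTC2 _ _ (fun y => p^-1 * y `^ p) _ _ a1).
  - rewrite powR1 mulr1 -EFinB lee_fin lerBlDr lerDl.
    by rewrite mulr_ge0 ?powR_ge0// invr_ge0 ltW.
  - apply: continuous_in_subspaceT => x /set_mem/=; rewrite in_itv/= => /andP[ax _].
    apply: differentiable_continuous; apply/derivable1_diffP.
    by apply: derivable_powR; rewrite in_itv/= andbT (lt_le_trans ainv).
  - split.
    + move=> x; rewrite in_itv/= => /andP[ax _].
      by case: (dG x (lt_trans ainv ax)).
    + by apply: cvg_at_right_filter; exact: cG.
    + by apply: cvg_at_left_filter; exact: cG.
  - move=> x; rewrite in_itv/= => /andP[ax _].
    by have [? <-] := dG x (lt_trans ainv ax); rewrite derive1E.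
have mpow : measurable_fun setT (fun u : R => (u `^ (p - 1))%:E).
  by apply/measurable_EFinP; exact: measurable_powR.
have mF n : measurable (F n) by exact: measurable_itv.
have UF : [set` `]0 : R, 1]] = \bigcup_n F n.
  apply/seteqP; split => x /=.
    rewrite in_itv/= => /andP[x0 x1]; exists (Num.truncn x^-1) => //.
    rewrite /F/= in_itv/= x1 andbT invf_ple ?posrE//.
    exact/ltW/truncnS_gt.
  move=> [n _]; rewrite /F/= !in_itv/= => /andP[nx ->]; rewrite andbT.
  by rewrite (lt_le_trans _ nx)// invr_gt0.
suff : mu.-integrable `]0, 1] (fun u => (u `^ (p - 1))%:E).
  by apply: integrableS => //; exact: subset_itv_oo_oc.
apply/integrableP; split; first exact: measurable_funTS.
rewrite (@le_lt_trans _ _ (p^-1)%:E)//; last by rewrite ltry.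
under eq_integral do rewrite /= ger0_norm ?powR_ge0//.
rewrite UF.
have cv : (\int[mu]_(x in F n) (x `^ (p - 1))%:E @[n --> \oo] -->
    \int[mu]_(x in \bigcup_n F n) (x `^ (p - 1))%:E)%E.
  apply: ge0_nondecreasing_set_cvg_integral => //.
  - apply/nondecreasing_seqP => n; apply/subsetPset; apply: subset_itvr.
    by rewrite bnd_simp lef_pV2 ?posrE// ler_nat.
  - by move=> n; exact: measurable_funTS.
  - by move=> n x _; rewrite lee_fin powR_ge0.
by apply: (cvge_to_le cv); apply: nearW => n; exact: Fn.
Qed.

(** The power is monotone in [x], with direction given by the sign of [q], so its maximum is at 1 or
    at 1/2; the sum of both endpoint values covers both signs. *)
Lemma powR_le_half (q x : R) : 2^-1 <= x <= 1 -> x `^ q <= 1 + 2^-1 `^ q.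
Proof.
move=> /andP[x2 x1]; have x0 : 0 < x by rewrite (lt_le_trans _ x2).
have [q0|q0] := leP 0 q.
  apply: (@le_trans _ _ (1 `^ q)); last by rewrite powR1 lerDl powR_ge0.
  by apply: ge0_ler_powR => //; rewrite nnegrE// ltW.
rewrite -[leLHS]add0r lerD// -(opprK q).
have : 0 <= - q by rewrite oppr_ge0 ltW.
move: (- q) => r r0; rewrite !powRN lef_pV2 ?posrE ?powR_gt0//.
by apply: ge0_ler_powR => //; rewrite nnegrE ltW.
Qed.

(** The two singularities sit at opposite endpoints: on each half of the interval one factor is
    bounded by [P] or [Q], and the other is an integrable power. *)
Lemma integrable_beta (p q : R) : 0 < p -> 0 < q ->
  mu.-integrable `]0, 1[ (fun u => ((1 - u) `^ (p - 1) * u `^ (q - 1))%:E).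
Proof.
move=> p0 q0.
pose P := 1 + 2^-1 `^ (p - 1) : R; pose Q := 1 + 2^-1 `^ (q - 1) : R.
have mow r : measurable_fun setT (fun u : R => (1 - u) `^ r).
  apply: (measurableT_comp (measurable_powR _)).
  exact: measurable_funB.
have i1 : mu.-integrable `]0, 1[ (fun u : R => ((1 - u) `^ (p - 1))%:E).
  (* The singularity at 1 is moved to 0 by the reflection [u |-> 1 - u]. *)
  have N10 : -1 != 0 :> R by rewrite oppr_eq0 oner_eq0.
  have := integrable_powR01 p0; rewrite integrable_mkcond//.
  move=> /(integrable_affine 1 N10) fi; rewrite integrable_mkcond//.
  apply: eq_integrable fi => // u _.
  have -> : -1 * u + 1 = 1 - u by ring.
  rewrite !patchE !mem_setE/=; rewrite !in_itv/= subr_gt0 ltrBlDr ltrDl.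
  by rewrite andbC.
have : mu.-integrable `]0, 1[
    (fun u => P%:E * (u `^ (q - 1))%:E + Q%:E * ((1 - u) `^ (p - 1))%:E)%E.
  by apply: integrableD => //; apply: integrableZl => //; exact: integrable_powR01.
apply: le_integrable => //.
- apply/measurable_EFinP; apply: measurable_funTS; apply: measurable_funM => //.
  exact: mow.
- move=> u/=; rewrite in_itv/= => /andP[u0 u1].
  rewrite lee_fin !ger0_norm; last 2 first.
    by rewrite addr_ge0// mulr_ge0 ?powR_ge0// addr_ge0 ?powR_ge0.
    by rewrite mulr_ge0 ?powR_ge0.
  have [u2|u2] := leP u 2^-1.
    rewrite -[leLHS]addr0 lerD//.
      rewrite ler_wpM2r ?powR_ge0// powR_le_half//; lra.
    by rewrite mulr_ge0 ?powR_ge0// addr_ge0 ?powR_ge0.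
  rewrite -[leLHS]add0r lerD//.
    by rewrite mulr_ge0 ?powR_ge0// addr_ge0 ?powR_ge0.
  rewrite mulrC ler_wpM2r ?powR_ge0// powR_le_half//; lra.
Qed.
End beta_weight.

(** Extension by zero makes every convolution an integral over the whole line, so that translations,
    reflections and Fubini need no care for the domain. *)
Definition pos_restrict (R : realType) (f : R -> R) : R -> R := f \_ `]0, +oo[.
Notation "f ^>" := (pos_restrict f) (at level 2, format "f ^>").

(** * Closure of the weighted spaces under convolution *)

Section weighted_continuous_functions.
Context {R : realType}.
Notation mu := (@lebesgue_measure R).

(** Precomposing with [Num.max 0] freezes the continuous factor at its value at 0 on the negative
    axis, which makes it continuous on the whole line. *)
Lemma weighted_continuous_extend (p : R) (f : R -> R) :
  weighted_continuous p f -> exists2 f1 : R -> R, continuous f1 &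
    forall t, 0 < t -> f t = t `^ (p - 1) * f1 t.
Proof.
move=> [f1 cf1 fE]; exists (fun x => f1 (Num.max 0 x)); last first.
  by move=> t t0; rewrite fE// max_r// ltW.
move=> x; have max0 : `[0, +oo[%classic (Num.max 0 x : R).
  by rewrite /= in_itv/= andbT le_max lexx.
have cmax : {for x, continuous (fun y : R => Num.max 0 y)}.
  exact: (@continuous_max _ _ (cst 0) id x (@cvg_cst _ _ _ _ _) (@cvg_id _ _)).
move/subspace_continuousP : cf1 => /(_ _ max0).
apply: (@cvg_comp _ _ _ (fun y => Num.max 0 y)) => A /= wA.
have : \forall y \near x, `[0, +oo[%classic (Num.max 0 y) -> A (Num.max 0 y).
  exact: cmax _ wA.
apply: filterS => y Ay; apply: Ay.
by rewrite /= in_itv/= andbT le_max lexx.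
Qed.

Lemma continuous_bounded_segment (f : R -> R) (M : R) : continuous f ->
  exists2 C, 0 <= C & forall x, `|x| <= M -> `|f x| <= C.
Proof.
move=> cf; have [M0|M0] := leP 0 M; last first.
  by exists 0 => // x xM; have := lt_le_trans M0 (le_trans _ xM); rewrite normr_ge0 ltxx => /(_ isT).
have MM : - M <= M by rewrite (le_trans _ M0)// oppr_le0.
have cn : {within `[- M, M], continuous (fun x => `|f x|)}.
  apply: continuous_subspaceT => x.
  by apply: continuous_comp; [exact: cf|exact: norm_continuous].
have [c _ cmax] := EVT_max MM cn.
by exists `|f c| => // x xM; apply: cmax; rewrite in_itv/= -ler_norml.
Qed.

Lemma pos_restrictT (f : R -> R) x : 0 < x -> f^> x = f x.
Proof. by move=> x0; rewrite /pos_restrict patchE mem_set//= in_itv/= x0. Qed.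

Lemma pos_restrictF (f : R -> R) x : x <= 0 -> f^> x = 0.
Proof.
by move=> x0; rewrite /pos_restrict patchE memNset//= in_itv/= andbT ltNge x0.
Qed.

Lemma measurable_pos_restrict (p : R) (f : R -> R) : weighted_continuous p f ->
  measurable_fun setT f^>.
Proof.
move=> /weighted_continuous_extend[f1 cf1 fE].
have -> : f^> = (fun t => t `^ (p - 1) * f1 t)^>.
  apply/funext => x; have [x0|x0] := ltP 0 x; last by rewrite !pos_restrictF.
  by rewrite !pos_restrictT// fE.
apply/(measurable_restrictT _ _).1 => //; apply: measurable_funTS.
apply: measurable_funM; first exact: measurable_powR.
exact: continuous_measurable_fun.
Qed.

Lemma pos_restrict_conv (f g : R -> R) t tau :
  f^> (t - tau) * g^> tau = ((fun s => f (t - s) * g s) \_ `]0, t[) tau.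
Proof.
rewrite patchE; case: ifPn => [|].
  rewrite inE/= in_itv/= => /andP[tau0 taut].
  by rewrite !pos_restrictT// subr_gt0.
rewrite notin_setE/= in_itv/= => /negP; rewrite negb_and -!leNgt => /orP[tau0|taut].
  by rewrite (pos_restrictF g)// mulr0.
by rewrite pos_restrictF ?mul0r// subr_le0.
Qed.

Lemma lconv_pos_restrict (f g : R -> R) t :
  lconv f g t = \int[mu]_tau (f^> (t - tau) * g^> tau).
Proof.
rewrite /lconv Rintegral_mkcond; apply: eq_Rintegral => tau _.
by rewrite pos_restrict_conv.
Qed.

Lemma lconv_defined_pos_restrict (f g : R -> R) t :
  lconv_defined f g t <->
  mu.-integrable setT (fun tau => (f^> (t - tau) * g^> tau)%:E).
Proof.
rewrite /lconv_defined integrable_mkcond//.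
have -> : (fun tau => (f (t - tau) * g tau)%:E) \_ `]0, t[ =
    (fun tau => (f^> (t - tau) * g^> tau)%:E).
  by apply/funext => tau; rewrite pos_restrict_conv !patchE; case: ifP.
by [].
Qed.

(* Substituting tau = t u in the convolution of t^(p-1) f1 and t^(q-1) g1 turns
   it into t^(p+q-1) times the average of h below; that average is continuous in
   t on the whole line, by dominated convergence against the beta weight W. *)
Section convolution.
Variables (p q : R) (f1 g1 : R -> R).
Hypotheses (p0 : 0 < p) (q0 : 0 < q).
Hypotheses (cf1 : continuous f1) (cg1 : continuous g1).

Let W (u : R) : R := (1 - u) `^ (p - 1) * u `^ (q - 1).
Let h (t u : R) : R := W u * (f1 (t * (1 - u)) * g1 (t * u)).

(** For [u] in the unit interval both [t * (1 - u)] and [t * u] stay in [[-M, M]], so one constant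
    serves all such [t]; this is the domination used below. *)
Let h_bound (M : R) : exists2 C : R, 0 <= C &
  forall t u, `|t| <= M -> 0 < u < 1 -> `|h t u| <= C * W u.
Proof.
have [Cf Cf0 fC] := continuous_bounded_segment M cf1.
have [Cg Cg0 gC] := continuous_bounded_segment M cg1.
exists (Cf * Cg); first by rewrite mulr_ge0.
move=> t u tM /andP[u0 u1]; rewrite /h normrM mulrC.
have W0 : 0 <= W u by rewrite mulr_ge0 ?powR_ge0.
rewrite (ger0_norm W0) ler_wpM2r// normrM ler_pM//.
  by apply: fC; rewrite normrM (le_trans _ tM)// ler_piMr// ger0_norm; lra.
by apply: gC; rewrite normrM (le_trans _ tM)// ler_piMr// ger0_norm; lra.
Qed.

Let mh t : measurable_fun setT (h t).
Proof.
apply: measurable_funM.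
  apply: measurable_funM; last exact: measurable_powR.
  by apply: (measurableT_comp (measurable_powR _)); exact: measurable_funB.
apply: measurable_funM.
  apply: measurableT_comp; first exact: continuous_measurable_fun.
  by apply: measurable_funM => //; exact: measurable_funB.
apply: measurableT_comp; first exact: continuous_measurable_fun.
exact: measurable_funM.
Qed.

Let integrable_h t : mu.-integrable `]0, 1[ (EFin \o h t).
Proof.
have [C C0 hC] := h_bound `|t|.
have : mu.-integrable `]0, 1[ (fun u => C%:E * (W u)%:E)%E.
  by apply: integrableZl => //; exact: integrable_beta.
apply: le_integrable => //.
  by apply/measurable_EFinP; apply: measurable_funTS; exact: mh.
move=> u /=; rewrite in_itv/= => u01; rewrite lee_fin.
by rewrite (le_trans (hC _ _ (lexx _) u01))// ler_norm.
Qed.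

Let F t := \int[mu]_(u in `]0, 1[) h t u.

Lemma continuous_scaled_integral : continuous F.
Proof.
(* The extra 1 places [x] inside the open interval on which the domination is uniform. *)
move=> x; pose M := `|x| + 1.
have [C C0 hC] := h_bound M.
have : {in [set` `]- M, M[], continuous (fun t => \int[mu]_(u in `]0, 1[) h t u)}.
  apply: (@continuity_under_integral _ _ _ mu h `]0, 1[ _ _ _ _ _ (fun u => C * W u)).
  - by [].
  - by move=> t _; exact: integrable_h.
  - apply: aeW => u _ t _.
    apply: cvgM; first exact: cvg_cst.
    apply: cvgM.
      apply: (@cvg_comp _ _ _ (fun t => t * (1 - u)) f1); last exact: cf1.
      by apply: cvgM; [exact: cvg_id|exact: cvg_cst].
    apply: (@cvg_comp _ _ _ (fun t => t * u) g1); last exact: cg1.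
    by apply: cvgM; [exact: cvg_id|exact: cvg_cst].
  - have : mu.-integrable `]0, 1[ (fun u => C%:E * (W u)%:E)%E.
      by apply: integrableZl => //; exact: integrable_beta.
    by [].
  - move=> t; rewrite /= in_itv/= -ltr_norml => /ltW tM.
    by apply: aeW => u /=; rewrite in_itv/= => u01; exact: hC.
apply; rewrite inE/= in_itv/= -ltr_norml /M; lra.
Qed.

Variables (f g : R -> R).
Hypothesis fE : forall t, 0 < t -> f t = t `^ (p - 1) * f1 t.
Hypothesis gE : forall t, 0 < t -> g t = t `^ (q - 1) * g1 t.

Let G (t u : R) : \bar R := ((h t \_ `]0, 1[) u)%:E.

Let integrable_G t : mu.-integrable setT (G t).
Proof.
have := integrable_h t; rewrite integrable_mkcond// => ih.
apply: eq_integrable ih => // u _.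
by rewrite /G !patchE; case: ifP.
Qed.

(** With [u = t^-1 * tau], homogeneity of the powers pulls out [t^(p-1) * t^(q-1)]; the summand 0
    gives the argument the affine shape of the substitution lemmas. *)
Let conv_G t tau : 0 < t -> (f^> (t - tau) * g^> tau)%:E =
  ((t `^ (p - 1) * t `^ (q - 1))%:E * G t (t^-1 * tau + 0)%R)%E.
Proof.
move=> t0; rewrite /G -EFinM addr0 pos_restrict_conv !patchE.
have -> : (t^-1 * tau \in `]0, 1[%classic) = (tau \in `]0, t[%classic).
  apply/idP/idP; rewrite !inE/= !in_itv/= pmulr_rgt0 ?invr_gt0//.
    by rewrite mulrC ltr_pdivrMr// mul1r.
  by rewrite mulrC ltr_pdivrMr// mul1r.
case: ifPn => [|_]; last by rewrite mulr0.
rewrite inE/= in_itv/= => /andP[tau0 taut]; congr EFin.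
have u1 : 0 < t - tau by rewrite subr_gt0.
have E1 : t * (1 - t^-1 * tau) = t - tau.
  by rewrite mulrBr mulr1 mulrA divff ?mul1r// gt_eqF.
have E2 : t * (t^-1 * tau) = tau by rewrite mulrA divff ?mul1r// gt_eqF.
have v0 : 0 <= t^-1 * tau by rewrite mulr_ge0 ?invr_ge0// ltW.
have v1 : 0 <= 1 - t^-1 * tau by rewrite subr_ge0 mulrC ler_pdivrMr// mul1r ltW.
have P1 : (t - tau) `^ (p - 1) = t `^ (p - 1) * (1 - t^-1 * tau) `^ (p - 1).
  by rewrite -powRM ?E1// ltW.
have P2 : tau `^ (q - 1) = t `^ (q - 1) * (t^-1 * tau) `^ (q - 1).
  by rewrite -powRM ?E2// ltW.
rewrite /h /W E1 E2 fE// gE// P1 [in LHS]P2; ring.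
Qed.

Lemma integrable_conv t : 0 < t ->
  mu.-integrable setT (fun tau => (f^> (t - tau) * g^> tau)%:E).
Proof.
move=> t0; have tV0 : t^-1 != 0 by rewrite invr_neq0// gt_eqF.
have : mu.-integrable setT (fun tau =>
    (t `^ (p - 1) * t `^ (q - 1))%:E * G t (t^-1 * tau + 0)%R)%E.
  by apply: integrableZl => //; exact: (integrable_affine 0 tV0).
by apply: eq_integrable => // tau _; rewrite conv_G.
Qed.

Lemma lconv_scaling t : 0 < t -> lconv f g t = t `^ (p + q - 1) * F t.
Proof.
move=> t0; have tV0 : t^-1 != 0 by rewrite invr_neq0// gt_eqF.
rewrite lconv_pos_restrict /Rintegral.
under eq_integral do rewrite conv_G//.
rewrite integralZl//; last exact: (integrable_affine 0 tV0).
have := integral_affine 0 tV0 (integrable_G t).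
rewrite (_ : \int[mu]_x G t x = (F t)%:E)%E; last first.
  rewrite /F /Rintegral fineK; last by apply: integrable_fin_num => //; exact: integrable_h.
  rewrite [RHS]integral_mkcond; apply: eq_integral => u _.
  by rewrite /G !patchE; case: ifP.
move=> FE; have -> : (\int[mu]_x G t (t^-1 * x + 0)%R = (t * F t)%:E)%E.
  rewrite EFinM FE muleA -EFinM gtr0_norm ?invr_gt0// divff ?mul1e// gt_eqF//.
rewrite -EFinM/= mulrA; congr (_ * _).
(* The Jacobian [t] is written as [t^1], and the exponents add up:
   [(p-1) + (q-1) + 1 = p + q - 1]. *)
rewrite -[X in _ * X](powRr1 (ltW t0)).
rewrite -!powRD ?(gt_eqF t0) ?implybT//. congr (_ `^ _); ring.
Qed.

End convolution.

Lemma weighted_continuous_lconv (p q : R) (f g : R -> R) : 0 < p -> 0 < q ->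
  weighted_continuous p f -> weighted_continuous q g ->
  weighted_continuous (p + q) (lconv f g).
Proof.
move=> p0 q0 /weighted_continuous_extend[f1 cf1 fE].
move=> /weighted_continuous_extend[g1 cg1 gE].
eexists; last first.
  by move=> t t0; exact: (lconv_scaling p0 q0 cf1 cg1 fE gE t0).
by apply: continuous_subspaceT; exact: continuous_scaled_integral.
Qed.

Lemma Cm1_lconv (f g : R -> R) : Cm1 f -> Cm1 g -> Cm1 (lconv f g).
Proof.
move=> [p p0 fp] [q q0 gq]; exists (p + q); first exact: addr_gt0.
exact: weighted_continuous_lconv.
Qed.

(** For [t <= 0] the integrand vanishes identically. All real [t] are covered because the Fubini
    argument shifts [t] to [t - tau], of either sign. *)
Lemma Cm1_integrable_conv (f g : R -> R) t : Cm1 f -> Cm1 g ->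
  mu.-integrable setT (fun tau => (f^> (t - tau) * g^> tau)%:E).
Proof.
move=> [p p0 fp] [q q0 gq]; have [t0|t0] := ltP 0 t; last first.
  apply: eq_integrable (integrable0 _ _) => // tau _.
  rewrite pos_restrict_conv patchE memNset//= in_itv/=.
  by move=> /andP[tau0 /(lt_trans tau0)]; rewrite ltNge t0.
have [f1 cf1 fE] := weighted_continuous_extend fp.
have [g1 cg1 gE] := weighted_continuous_extend gq.
exact: (integrable_conv p0 q0 cf1 cg1 fE gE t0).
Qed.

Lemma Cm1_lconv_defined (f g : R -> R) t : Cm1 f -> Cm1 g -> lconv_defined f g t.
Proof.
by move=> fC gC; apply/lconv_defined_pos_restrict; exact: Cm1_integrable_conv.
Qed.

(** This turns absolute integrability of iterated convolutions into the existence of convolutions of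
    the absolute values. *)
Lemma Cm1_norm (f : R -> R) : Cm1 f -> Cm1 (fun t => `|f t|).
Proof.
move=> [p p0 /weighted_continuous_extend[f1 cf1 fE]]; exists p => //.
exists (fun t => `|f1 t|); last first.
  by move=> t t0; rewrite fE// normrM ger0_norm// powR_ge0.
apply: continuous_subspaceT => x.
by apply: continuous_comp; [exact: cf1|exact: norm_continuous].
Qed.

End weighted_continuous_functions.

(** * Commutativity and associativity of the convolution, and convolution with 1 *)

Section laplace_convolution.
Context {R : realType}.
Notation mu := (@lebesgue_measure R).

Lemma lconv_le0 (f g : R -> R) t : t <= 0 -> lconv f g t = 0.
Proof.
by move=> t0; rewrite /lconv set_itv_ge ?Rintegral_set0// bnd_simp -leNgt.
Qed.

Lemma pos_restrict_lconv (f g : R -> R) : (lconv f g)^> = lconv f g.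
Proof.
apply/funext => t; have [t0|t0] := ltP 0 t; first by rewrite pos_restrictT.
by rewrite pos_restrictF// lconv_le0.
Qed.

Lemma pos_restrict_norm (f : R -> R) : (fun t => `|f t|)^> = (fun t => `|f^> t|).
Proof.
apply/funext => t; have [t0|t0] := ltP 0 t; first by rewrite !pos_restrictT.
by rewrite !pos_restrictF// normr0.
Qed.

(** Over []0, t[] both [tau] and [t - tau] are positive, and for [t <= 0] the domain is empty; hence
    equality holds as functions on the whole line. *)
Lemma eq_lconv (f1 f2 g1 g2 : R -> R) :
  (forall t, 0 < t -> f1 t = f2 t) -> (forall t, 0 < t -> g1 t = g2 t) ->
  lconv f1 g1 = lconv f2 g2.
Proof.
move=> f12 g12; apply/funext => t; apply: eq_Rintegral => tau.
by rewrite inE/= in_itv/= => /andP[tau0 taut]; rewrite f12 ?g12// subr_gt0.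
Qed.

Lemma lconv_EFin (f g : R -> R) t : Cm1 f -> Cm1 g ->
  (\int[mu]_tau (f^> (t - tau) * g^> tau)%:E = (lconv f g t)%:E)%E.
Proof.
move=> fC gC; rewrite lconv_pos_restrict /Rintegral fineK//.
by apply: integrable_fin_num => //; exact: Cm1_integrable_conv.
Qed.

(** Reflection [tau |-> t - tau], which has Jacobian 1. *)
Lemma lconvC (f g : R -> R) : Cm1 f -> Cm1 g -> lconv f g = lconv g f.
Proof.
move=> fC gC; apply/funext => t; apply: EFin_inj; rewrite -!lconv_EFin//.
have N10 : -1 != 0 :> R by rewrite oppr_eq0 oner_eq0.
rewrite (integral_affine t N10 (Cm1_integrable_conv t fC gC)).
rewrite normrN1 mul1e; apply: eq_integral => tau _.
have -> : t - (-1 * tau + t) = tau by ring.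
have -> : -1 * tau + t = t - tau by ring.
by rewrite mulrC.
Qed.

Lemma integral_conv_shift (f g : R -> R) t tau : Cm1 f -> Cm1 g ->
  (\int[mu]_s (f^> (t - s) * g^> (s - tau))%:E = (lconv f g (t - tau))%:E)%E.
Proof.
move=> fC gC; rewrite -lconv_EFin//.
rewrite (integral_affine (- tau) (oner_neq0 _) (Cm1_integrable_conv (t - tau) fC gC)).
rewrite normr1 mul1e; apply: eq_integral => s _; rewrite mul1r.
by have -> : t - tau - (s - tau) = t - s by ring.
Qed.

Lemma integrable_conv_shift (f g : R -> R) t tau : Cm1 f -> Cm1 g ->
  mu.-integrable setT (fun s => (f^> (t - s) * g^> (s - tau))%:E).
Proof.
move=> fC gC.
have := integrable_affine (- tau) (oner_neq0 _) (Cm1_integrable_conv (t - tau) fC gC).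
apply: eq_integrable => // s _; rewrite mul1r.
by have -> : t - tau - (s - tau) = t - s by ring.
Qed.

Lemma Cm1_measurable (f : R -> R) : Cm1 f -> measurable_fun setT f^>.
Proof. by move=> [p _ /measurable_pos_restrict]. Qed.

(* The integrand of the Fubini argument; integrating x.1 first gives the
   convolution of f and g evaluated at t - x.2. *)
Let triple (f g h : R -> R) t (x : R * R) : R :=
  f^> (t - x.1) * g^> (x.1 - x.2) * h^> x.2.

Let integral_triple (f g h : R -> R) t tau : Cm1 f -> Cm1 g -> Cm1 h ->
  (\int[mu]_s (triple f g h t (s, tau))%:E =
   (lconv f g (t - tau) * h^> tau)%:E)%E.
Proof.
move=> fC gC hC; rewrite mulrC EFinM -integral_conv_shift//.
rewrite -integralZl//; last exact: integrable_conv_shift.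
by apply: eq_integral => s _; rewrite /triple/= mulrC.
Qed.

(** By Tonelli it is enough to bound an iterated integral of the absolute value, and that is the
    double convolution of the absolute values, hence finite. *)
Let integrable_triple (f g h : R -> R) t : Cm1 f -> Cm1 g -> Cm1 h ->
  (mu \x mu)%E.-integrable setT (EFin \o triple f g h t).
Proof.
move=> fC gC hC; apply/integrable21ltyP.
  apply/measurable_EFinP; apply: measurable_funM; last first.
    apply: measurableT_comp; first exact: Cm1_measurable.
    exact: measurable_snd.
  apply: measurable_funM.
    apply: measurableT_comp; first exact: Cm1_measurable.
    by apply: measurable_funB => //; exact: measurable_fst.
  apply: measurableT_comp; first exact: Cm1_measurable.
  by apply: measurable_funB; [exact: measurable_fst|exact: measurable_snd].
have nfC := Cm1_norm fC; have ngC := Cm1_norm gC; have nhC := Cm1_norm hC.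
have E tau : (\int[mu]_s `|(EFin \o triple f g h t) (s, tau)| =
    (lconv (Num.norm \o f) (Num.norm \o g) (t - tau) * (Num.norm \o h)^> tau)%:E)%E.
  rewrite -integral_triple//; apply: eq_integral => s _.
  by rewrite /triple/= !normrM !pos_restrict_norm.
under eq_integral do rewrite E.
rewrite -(pos_restrict_lconv (Num.norm \o f)) lconv_EFin//; last exact: Cm1_lconv.
exact: ltry.
Qed.

(** The two sides are the two iterated integrals of [triple]: [tau] innermost gives the left one,
    [s] innermost the right one. *)
Lemma lconvA (f g h : R -> R) : Cm1 f -> Cm1 g -> Cm1 h ->
  lconv f (lconv g h) = lconv (lconv f g) h.
Proof.
move=> fC gC hC; apply/funext => t; apply: EFin_inj.
rewrite -!lconv_EFin//; try exact: Cm1_lconv.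
rewrite !pos_restrict_lconv.
transitivity (\int[mu]_s \int[mu]_tau (EFin \o triple f g h t) (s, tau))%E.
  apply: eq_integral => s _; rewrite EFinM -lconv_EFin//.
  rewrite -integralZl//; last exact: Cm1_integrable_conv.
  by apply: eq_integral => tau _; rewrite /triple/= -EFinM mulrA.
rewrite (Fubini (integrable_triple t fC gC hC)).
by apply: eq_integral => tau _; rewrite integral_triple.
Qed.

Lemma weighted_continuous_one : weighted_continuous 1 (fun=> 1 : R).
Proof.
exists (fun=> 1); first by apply: continuous_subspaceT => x; exact: cvg_cst.
by move=> t t0; rewrite subrr powRr0 mul1r.
Qed.

Lemma Cm1_one : Cm1 (fun=> 1 : R).
Proof. by exists 1 => //; exact: weighted_continuous_one. Qed.

Lemma Cm1_continuous (f : R -> R) t : Cm1 f -> 0 < t -> {for t, continuous f}.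
Proof.
move=> [p p0 /weighted_continuous_extend[f1 cf1 fE]] t0.
have cp : {for t, continuous (fun x : R => x `^ (p - 1))}.
  apply: differentiable_continuous; apply/derivable1_diffP.
  by apply: derivable_powR; rewrite in_itv/= t0.
suff : f x @[x --> t] --> f t by [].
rewrite fE//; apply: cvg_trans (cvgM cp (cf1 t)).
apply: near_eq_cvg; near=> x; rewrite fE//.
by near: x; exact: lt_nbhsr.
Unshelve. all: by end_near. Qed.

Lemma derive_lconv_one (f : R -> R) t : Cm1 f -> 0 < t ->
  derivable (lconv (fun=> 1) f) t 1 /\ derive1 (lconv (fun=> 1) f) t = f t.
Proof.
move=> fC t0.
have fi (x : R) : mu.-integrable `]0, x[ (EFin \o f).
  have : lconv_defined (fun=> 1) f x by apply: Cm1_lconv_defined => //; exact: Cm1_one.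
  by apply: eq_integrable => // y _; rewrite mul1r.
(* The fundamental theorem integrates up to and including the right endpoint; integrability there is
   inherited from the longer interval []0, x + 1[]. *)
have fi' (x : R) : mu.-integrable `]0, x] (EFin \o f).
  by apply: integrableS (fi (x + 1)) => //; apply: subset_itvl; rewrite bnd_simp ltrDl.
have -> : lconv (fun=> 1) f = (fun x => \int[mu]_(s in [set` `]0, x]]) f s).
  apply/funext => x; rewrite -Rintegral_itv_bndo_bndc//.
  by apply: eq_Rintegral => s _; rewrite mul1r.
apply: (@continuous_FTC1 _ f (BRight 0) t (t + 1)) => //.
- by rewrite ltrDl.
- exact: Cm1_continuous.
Qed.

(** Convolution with 1 raises the weight exponent from [p] to [1 + p], so the result is [x^p] with
    [p > 0] times a function continuous at 0. *)
Lemma lconv_one_cvg0 (f : R -> R) : Cm1 f -> lconv (fun=> 1) f x @[x --> 0^'+] --> 0.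
Proof.
move=> [p p0 fp].
have /weighted_continuous_extend[f1 cf1 fE] :=
  weighted_continuous_lconv ltr01 p0 weighted_continuous_one fp.
have f10 : f1 x @[x --> 0^'+] --> f1 0 by apply: cvg_at_right_filter; exact: cf1.
have cv0 : x `^ p * f1 x @[x --> 0^'+] --> 0.
  by rewrite -[X in _ --> X](mul0r (f1 0)); apply: cvgM f10; exact: powR_cvg0.
suff eq_f : {near 0^'+, (fun x => x `^ p * f1 x) =1 lconv (fun=> 1) f}.
  exact: cvg_trans (near_eq_cvg eq_f) cv0.
near=> x; rewrite fE; last by near: x; exact: nbhs_right_gt.
by congr (_ `^ _ * _); ring.
Unshelve. all: by end_near. Qed.

End laplace_convolution.

(** * The left inverse property of both derivatives *)

Theorem theorem4p1 (R : realType) (kappa k : R -> R)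
    (kappaS : @Sm1 R kappa) (kappa_k : associate_sonine_kernel kappa k) :
  (forall f : R -> R, @Cm1 R f -> forall t : R, 0 < t ->
     [/\ lconv_defined kappa f t,
         GFD_RL_defined k (GFI kappa f) t
       & GFD_RL k (GFI kappa f) t = f t]) /\
  (forall f : R -> R, Cm1_k k f -> forall t : R, 0 < t ->
     [/\ lconv_defined kappa f t,
         GFD_Caputo_defined k (GFI kappa f) t
       & GFD_Caputo k (GFI kappa f) t = f t]).
Proof.
have kappaC : Cm1 kappa by case: kappaS => -[p /andP[p0 _] ?] _; exists p.
have [[p /andP[p0 _] kp] sonine] := kappa_k.
have kC : Cm1 k by exists p.
have kkappa (f : R -> R) : Cm1 f -> lconv k (lconv kappa f) = lconv (fun=> 1) f.
  move=> fC; rewrite lconvA// (lconvC kC kappaC).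
  by apply: eq_lconv => // t t0; rewrite sonine.
have RL (f : R -> R) : Cm1 f -> forall t : R, 0 < t ->
    [/\ lconv_defined kappa f t, GFD_RL_defined k (GFI kappa f) t
      & GFD_RL k (GFI kappa f) t = f t].
  move=> fC t t0; have [d1 d2] := derive_lconv_one fC t0.
  split; first exact: Cm1_lconv_defined.
  - split; last by rewrite /GFI kkappa.
    by move=> s _; apply: Cm1_lconv_defined => //; exact: Cm1_lconv.
  - by rewrite /GFD_RL /GFI kkappa.
split => // f [phi phiC fE] t t0.
(* [f] agrees with [k * phi] at positive arguments only, so the weighted representation is
   transferred rather than the function rewritten. *)
have fC : Cm1 f.
  have [q q0 [f1 cf1 E]] := Cm1_lconv kC phiC.
  by exists q => //; exists f1 => // s s0; rewrite fE// /GFI E.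
have [def_f def_RL RLE] := RL f fC t t0.
have f0 : GFI kappa f x @[x --> 0^'+] --> 0.
  have -> : GFI kappa f = lconv (fun=> 1) phi.
    rewrite /GFI (eq_lconv (fun _ _ => erefl) fE) lconvA//.
    by apply: eq_lconv => // s s0; rewrite sonine.
  exact: lconv_one_cvg0.
split => //; first by split => //; apply/cvg_ex; exists 0.
by rewrite /GFD_Caputo /value0 (cvg_lim _ f0)// mul0r subr0.
Qed.
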